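(* Let $R$ be an involutive ($R^2=I$) skew-invertible symmetry on $V$. Then the commutation relations among the generators $\{l_i^j\}$ of the algebra $U_R(\mathrm{End}(V))$ are equivalent to $$\bar R_{12}L_1\bar R_{12}L_1-L_1\bar R_{12}L_1\bar R_{12}-(\bar R_{12}L_1-L_1\bar R_{12})=0 .$$ Therefore the algebra $U_R(\mathrm{End}(V))$ coincides with the modified reflection equation algebra $\mathcal L(R,1)$ (that is, with $\hbar=1$).
   Context: $V$ is a finite dimensional vector space over $\mathbb K$ ($\mathbb K=\mathbb C$ mainly), $N=\dim V$, with basis $\{x_i\}$; $V^*$ is the dual space with basis $\{x^i\}$, $\langle x_i,x^j\rangle_r=\delta_i^j$. Summation over repeated indices is understood. An involutive symmetry is an operator $R$ on $V^{\otimes2}$, $R(x_i\otimes x_j)=x_k\otimes x_lR^{kl}_{\;ij}$, with $R_{12}R_{23}R_{12}=R_{23}R_{12}R_{23}$ and $R^2=I$ (a Hecke symmetry at $q=1$). It is skew-invertible if there is $\Psi$ with $R^{ia}_{\;jb}\Psi^{bl}_{\;ak}=\delta^i_k\delta^l_j=\Psi^{ia}_{\;jb}R^{bl}_{\;ak}$. Put $B^j_{\;i}=\Psi^{kj}_{\;ki}$. Extend $R$ to $(V\oplus V^* )^{\otimes2}$ by $R(x_i\otimes x^j)=x^k\otimes x_l(R^{-1})^{lj}_{\;ki}$, $R(x^j\otimes x_i)=x_k\otimes x^l\Psi^{kj}_{\;li}$, $R(x^i\otimes x^j)=x^k\otimes x^lR^{ji}_{\;lk}$, $R(x_i\otimes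 x_j)=x_k\otimes x_lR^{kl}_{\;ij}$. Identify $\mathrm{End}(V)$ with $V\otimes V^*$ with basis $l_i^j=x_i\otimes x^j$, where $l_i^j(x_k)=B^j_{\;k}x_i$, so that the composition product is $l_i^j\circ l_k^s=B^j_{\;k}\,l_i^s$. The braiding $R_{\mathrm{End}}$ on $\mathrm{End}(V)^{\otimes2}=V\otimes V^*\otimes V\otimes V^*$ is $R_{\mathrm{End}}=R_{23}R_{12}R_{34}R_{23}$, where $R_{i,i+1}$ is the extended braiding in the $i$-th and $(i+1)$-th factors. Define $$U_R(\mathrm{End}(V))=T(\mathrm{End}(V))/\langle X\otimes Y-R_{\mathrm{End}}(X\otimes Y)-X\circ Y+\circ R_{\mathrm{End}}(X\otimes Y)\;:\;X,Y\in\mathrm{End}(V)\rangle .$$ $\bar R$ is the transposed matrix, $\bar R_{i_1i_2}^{\;\,j_1j_2}=R^{j_1j_2}_{\;\,i_1i_2}$ (lower indices number rows, upper indices columns), $L$ is the $N\times N$ matrix with entries $L_i^{\;j}=l_i^j$ ($i$ the row index), $L_1=L\otimes I$. The algebra $\mathcal L(R,\hbar)$ is the unital associative algebra generated by $l_i^j$, $1\le i,j\le N$, with relations $\bar R_{12}L_1\bar R_{12}L_1-L_1\bar R_{12}L_1\bar R_{12}-\hbar(\bar R_{12}L_1-L_1\bar R_{12})=0$. *)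

(* Defs.v *)
From HB Require Import structures.
From mathcomp Require Import all_boot all_order all_algebra generic_quotient.
From mathcomp.real_closed Require Import mxtens.
From mathcomp.multinomials Require Import monalg.
From mathcomp.classical Require Import boolp.

Set Implicit Arguments.
Unset Strict Implicit.
Unset Printing Implicit Defensive.

Import GRing.Theory.
Local Open Scope ring_scope.
Local Open Scope quotient_scope.

Section TwoSidedIdeal.
Variables (T : nzRingType) (S : T -> Prop).

Inductive ideal_gen : T -> Prop :=
| ideal_gen_in x of S x : ideal_gen x
| ideal_gen0 : ideal_gen 0
| ideal_genD x y of ideal_gen x & ideal_gen y : ideal_gen (x + y)
| ideal_genMl a x of ideal_gen x : ideal_gen (a * x)
| ideal_genMr a x of ideal_gen x : ideal_gen (x * a).

Definition idealb : {pred T} := fun x => `[< ideal_gen x >].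

Lemma idealbP x : reflect (ideal_gen x) (x \in idealb).
Proof. exact: asboolP. Qed.

Lemma idealb_zmod : zmod_closed idealb.
Proof.
split=> [|x y /idealbP Ix /idealbP Iy]; apply/idealbP; first exact: ideal_gen0.
by rewrite -mulN1r; apply: ideal_genD => //; apply: ideal_genMl.
Qed.

HB.instance Definition _ := GRing.isZmodClosed.Build T idealb idealb_zmod.

Lemma idealbMl a x : x \in idealb -> a * x \in idealb.
Proof. by move=> /idealbP Ix; apply/idealbP/ideal_genMl. Qed.

Lemma idealbMr a x : x \in idealb -> x * a \in idealb.
Proof. by move=> /idealbP Ix; apply/idealbP/ideal_genMr. Qed.

End TwoSidedIdeal.

(* T / <S>; algebras being non-trivial rings here, <S> has to be proper. *)
Section Presented.
Variables (K : comNzRingType) (T : algType K) (S : T -> Prop).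
Hypothesis S1 : ~ ideal_gen S 1.

Definition presented (_ : ~ ideal_gen S 1) : Type := Quotient.quot (idealb S).
Local Notation Q := (presented S1).

HB.instance Definition _ := GRing.Zmodule.on Q.

Definition to_presented (x : T) : Q := \pi_(Quotient.quot (idealb S)) x.
Definition presented_repr (u : Q) : T := repr u.

Lemma presented_reprK u : to_presented (presented_repr u) = u.
Proof. exact: reprK. Qed.

Lemma to_presentedP x y :
  to_presented x = to_presented y <-> ideal_gen S (x - y).
Proof.
rewrite /to_presented; split=> [/eqP|Ixy].
  by rewrite -Quotient.idealrBE => /idealbP.
by apply/eqP; rewrite -Quotient.idealrBE; apply/idealbP.
Qed.

Lemma to_presentedD x y :
  to_presented (x + y) = to_presented x + to_presented y.
Proof. exact: (@Quotient.pi_add T (idealb S)). Qed.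

Lemma to_presented0 : to_presented 0 = 0.
Proof. by apply: (addrI (to_presented 0)); rewrite -to_presentedD !addr0. Qed.

Lemma presented_reprB x :
  ideal_gen S (presented_repr (to_presented x) - x).
Proof. by apply/to_presentedP; rewrite presented_reprK. Qed.

Definition pres_one := to_presented 1.
Definition pres_mul u v := to_presented (presented_repr u * presented_repr v).
Definition pres_scale (a : K) u := to_presented (a *: presented_repr u).

Lemma pres_mulE x y :
  pres_mul (to_presented x) (to_presented y) = to_presented (x * y).
Proof.
apply/to_presentedP; set x' := presented_repr _; set y' := presented_repr _.
have -> : x' * y' - x * y = (x' - x) * y' + x * (y' - y).
  by rewrite mulrBl mulrBr addrA subrK.
by apply: ideal_genD; [apply: ideal_genMr|apply: ideal_genMl];
  apply: presented_reprB.
Qed.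

Lemma pres_scaleE a x : pres_scale a (to_presented x) = to_presented (a *: x).
Proof.
apply/to_presentedP; rewrite -scalerBr -[_ - x]mul1r scalerAl.
by apply: ideal_genMl; apply: presented_reprB.
Qed.

Lemma pres_ind (P : Q -> Prop) :
  (forall x, P (to_presented x)) -> forall u, P u.
Proof. by move=> Px u; rewrite -[u]presented_reprK. Qed.

Lemma pres_mulA : associative pres_mul.
Proof.
elim/pres_ind=> x; elim/pres_ind=> y; elim/pres_ind=> z.
by rewrite !pres_mulE mulrA.
Qed.
Lemma pres_mul1 : left_id pres_one pres_mul.
Proof. by elim/pres_ind=> x; rewrite pres_mulE mul1r. Qed.
Lemma pres_mulr1 : right_id pres_one pres_mul.
Proof. by elim/pres_ind=> x; rewrite pres_mulE mulr1. Qed.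
Lemma pres_mulDl : left_distributive pres_mul +%R.
Proof.
elim/pres_ind=> x; elim/pres_ind=> y; elim/pres_ind=> z.
by rewrite -to_presentedD !pres_mulE -to_presentedD mulrDl.
Qed.
Lemma pres_mulDr : right_distributive pres_mul +%R.
Proof.
elim/pres_ind=> x; elim/pres_ind=> y; elim/pres_ind=> z.
by rewrite -to_presentedD !pres_mulE -to_presentedD mulrDr.
Qed.
Lemma pres_one_neq0 : pres_one != 0.
Proof.
by apply/eqP; rewrite -to_presented0 => /to_presentedP; rewrite subr0.
Qed.
HB.instance Definition _ := GRing.Zmodule_isNzRing.Build Q
  pres_mulA pres_mul1 pres_mulr1 pres_mulDl pres_mulDr pres_one_neq0.

Lemma pres_scaleA a b u :
  pres_scale a (pres_scale b u) = pres_scale (a * b) u.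
Proof. by elim/pres_ind: u => x; rewrite !pres_scaleE scalerA. Qed.
Lemma pres_scale1 : left_id 1 pres_scale.
Proof. by elim/pres_ind=> x; rewrite pres_scaleE scale1r. Qed.
Lemma pres_scaleDr : right_distributive pres_scale +%R.
Proof.
move=> a; elim/pres_ind=> x; elim/pres_ind=> y.
by rewrite -to_presentedD !pres_scaleE -to_presentedD scalerDr.
Qed.
Lemma pres_scaleDl u : {morph pres_scale^~ u : a b / a + b}.
Proof.
by elim/pres_ind: u => x a b; rewrite !pres_scaleE -to_presentedD scalerDl.
Qed.
HB.instance Definition _ := GRing.Zmodule_isLmodule.Build K Q
  pres_scaleA pres_scale1 pres_scaleDr pres_scaleDl.

Lemma pres_scaleAl (a : K) (u v : Q) : a *: (u * v) = (a *: u) * v.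
Proof.
elim/pres_ind: u => x; elim/pres_ind: v => y.
change (pres_scale a (pres_mul (to_presented x) (to_presented y)) =
        pres_mul (pres_scale a (to_presented x)) (to_presented y)).
by rewrite !(pres_mulE, pres_scaleE) scalerAl.
Qed.
HB.instance Definition _ :=
  GRing.Lmodule_isLalgebra.Build K Q pres_scaleAl.

Lemma pres_scaleAr (a : K) (u v : Q) : a *: (u * v) = u * (a *: v).
Proof.
elim/pres_ind: u => x; elim/pres_ind: v => y.
change (pres_scale a (pres_mul (to_presented x) (to_presented y)) =
        pres_mul (to_presented x) (pres_scale a (to_presented y))).
by rewrite !(pres_mulE, pres_scaleE) scalerAr.
Qed.
HB.instance Definition _ :=
  GRing.Lalgebra_isAlgebra.Build K Q pres_scaleAr.

Lemma to_presented_zmod : zmod_morphism to_presented.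
Proof.
move=> x y; rewrite to_presentedD; congr (_ + _).
by apply: (addrI (to_presented y)); rewrite -to_presentedD !subrr to_presented0.
Qed.
HB.instance Definition _ :=
  GRing.isZmodMorphism.Build T Q to_presented to_presented_zmod.

Lemma to_presented_monoid : monoid_morphism to_presented.
Proof. by split=> // x y; rewrite -pres_mulE. Qed.
HB.instance Definition _ :=
  GRing.isMonoidMorphism.Build T Q to_presented to_presented_monoid.

Lemma to_presented_scalable : scalable to_presented.
Proof. by move=> a x; rewrite -pres_scaleE. Qed.
HB.instance Definition _ :=
  GRing.isScalable.Build K T Q *:%R to_presented to_presented_scalable.

End Presented.

Section FreeAlgebra.
Variables (K : comNzRingType) (I : choiceType).
Local Notation M := {malg K[{fmonom I}]}.

Lemma malg_mulC (c : K) (x : M) : x * c%:MP = c%:MP * x.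
Proof.
rewrite !malgM_def fgmulgU fgmulUg; apply: eq_bigr => k _.
by rewrite mulrC mulm1 mul1m.
Qed.

Lemma malg_scaleAr (a : K) (x y : M) : a *: (x * y) = x * (a *: y).
Proof. by rewrite -!mul_malgC !mulrA malg_mulC. Qed.

(* Renamed because {malg _[_]} only carries an algType structure for
   commutative monoids. *)
Definition free_alg : Type := M.
HB.instance Definition _ := GRing.Lalgebra.on free_alg.
HB.instance Definition _ :=
  GRing.Lalgebra_isAlgebra.Build K free_alg malg_scaleAr.

Definition free_gen (i : I) : free_alg := (<< fmu i >> : M).

Definition free_aug (x : free_alg) : K := mcoeff mone (x : M).

Lemma free_aug_zmod : zmod_morphism free_aug.
Proof. exact: (raddfB (mcoeff mone : M -> K)). Qed.
HB.instance Definition _ :=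
  GRing.isZmodMorphism.Build free_alg K free_aug free_aug_zmod.
Lemma free_aug_monoid : monoid_morphism free_aug.
Proof. by have [fM f1] := mcoeff1g_is_multiplicative (fmonom I) K. Qed.
HB.instance Definition _ :=
  GRing.isMonoidMorphism.Build free_alg K free_aug free_aug_monoid.
Lemma free_aug_scalable : scalable_for *%R free_aug.
Proof. by move=> a x; apply: mcoeffZ. Qed.
HB.instance Definition _ :=
  GRing.isScalable.Build K free_alg K *%R free_aug free_aug_scalable.

Lemma free_aug_gen i : free_aug (free_gen i) = 0.
Proof. by rewrite /free_aug mcoeffU1 -val_eqE /= fm1 fmuE. Qed.

Lemma aug_proper (S : free_alg -> Prop) :
  (forall x, S x -> free_aug x = 0) -> ~ ideal_gen S 1.
Proof.
move=> S0 S1; suff: free_aug 1 = 0.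
  by rewrite rmorph1 => /eqP; rewrite oner_eq0.
elim: S1 => [x /S0 //||x y _ x0 _ y0|a x _ x0|a x _ x0].
- by rewrite rmorph0.
- by rewrite rmorphD /= x0 y0 addr0.
- by rewrite rmorphM /= x0 mulr0.
- by rewrite rmorphM /= x0 mul0r.
Qed.

End FreeAlgebra.

Section Braiding.
Variables (K : fieldType) (N : nat).
Implicit Types R Psi : 'M[K]_(N * N).

(* A^{kl}_{ij}, with A (x_i (x) x_j) = \sum_(k, l) A^{kl}_{ij} x_k (x) x_l:
   upper indices number the rows, lower indices the columns. *)
Definition coef2 (A : 'M[K]_(N * N)) (k l i j : 'I_N) : K :=
  A (mxtens_index (k, l)) (mxtens_index (i, j)).

Definition braid12 R : 'M[K]_(N * N * N) := R *t 1%:M.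
Definition braid23 R : 'M[K]_(N * N * N) :=
  castmx (mulnA N N N, mulnA N N N) (1%:M *t R).

Definition involutive_symmetry R :=
  braid12 R *m braid23 R *m braid12 R = braid23 R *m braid12 R *m braid23 R
  /\ R *m R = 1%:M.

Definition skew_inverse R Psi := forall i j k l : 'I_N,
  \sum_a \sum_b coef2 R i a j b * coef2 Psi b l a k
    = (i == k)%:R * (l == j)%:R
  /\ \sum_a \sum_b coef2 Psi i a j b * coef2 R b l a k
    = (i == k)%:R * (l == j)%:R.

(* Row index up, column index down: B^j_i = Psi^{kj}_{ki}. *)
Definition Bmx Psi : 'M[K]_N := \matrix_(j, i) \sum_k coef2 Psi k j k i.

(* The basis of V (+) V^*: inl i stands for x_i, inr i for x^i. *)
Definition dbasis := ('I_N + 'I_N)%type.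

(* ext_braid R Psi c d a b is the coefficient of c (x) d in the image of
   a (x) b under the extended braiding. *)
Definition ext_braid R Psi (c d a b : dbasis) : K :=
  match a, b, c, d with
  | inl i, inl j, inl k, inl l => coef2 R k l i j
  | inl i, inr j, inr k, inl l => coef2 (invmx R) l j k i
  | inr j, inl i, inl k, inr l => coef2 Psi k j l i
  | inr i, inr j, inr k, inr l => coef2 R j i l k
  | _, _, _, _ => 0
  end.

(* Elements of the fourth tensor power of V (+) V^*, by coordinates. *)
Definition tensor4 := dbasis -> dbasis -> dbasis -> dbasis -> K.

Definition ext_braid12 R Psi (v : tensor4) : tensor4 := fun a b c d =>
  \sum_a' \sum_b' ext_braid R Psi a b a' b' * v a' b' c d.
Definition ext_braid23 R Psi (v : tensor4) : tensor4 := fun a b c d =>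
  \sum_b' \sum_c' ext_braid R Psi b c b' c' * v a b' c' d.
Definition ext_braid34 R Psi (v : tensor4) : tensor4 := fun a b c d =>
  \sum_c' \sum_d' ext_braid R Psi c d c' d' * v a b c' d'.

Definition braid_word R Psi (v : tensor4) : tensor4 :=
  ext_braid23 R Psi (ext_braid12 R Psi (ext_braid34 R Psi
    (ext_braid23 R Psi v))).

(* End(V) (x) End(V) = V (x) V^* (x) V (x) V^*: T i j k s is the coefficient
   of l_i^j (x) l_k^s.  An element X of End(V) is given by the matrix of its
   coefficients on the l_i^j. *)
Definition End2 := 'I_N -> 'I_N -> 'I_N -> 'I_N -> K.

Definition End2_tensor (X Y : 'M[K]_N) : End2 := fun i j k s => X i j * Y k s.

Definition End2_incl (T : End2) : tensor4 := fun a b c d =>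
  match a, b, c, d with
  | inl i, inr j, inl k, inr s => T i j k s
  | _, _, _, _ => 0
  end.

Definition braid_End R Psi (T : End2) : End2 := fun i j k s =>
  braid_word R Psi (End2_incl T) (inl i) (inr j) (inl k) (inr s).

Definition End2_comp Psi (T : End2) : 'M[K]_N :=
  \matrix_(i, s) \sum_j \sum_k T i j k s * Bmx Psi j k.

(* Matrix of X in the basis x_i, since l_i^j (x_k) = B^j_k x_i. *)
Definition End_op Psi (X : 'M[K]_N) : 'M[K]_N := X *m Bmx Psi.

Lemma End_op_comp Psi X Y :
  End_op Psi (End2_comp Psi (End2_tensor X Y)) = End_op Psi X *m End_op Psi Y.
Proof.
rewrite /End_op mulmxA; congr (_ *m _); rewrite -mulmxA; apply/matrixP=> i s.
rewrite !mxE; apply: eq_bigr => j _; rewrite mxE big_distrr /=.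
by apply: eq_bigr => k _; rewrite /End2_tensor mulrAC mulrA.
Qed.

Definition in_V (a : dbasis) : bool := if a is inl _ then true else false.

Definition supp4 (t1 t2 t3 t4 : bool) (v : tensor4) := forall a b c d,
  v a b c d != 0 -> [/\ in_V a = t1, in_V b = t2, in_V c = t3 & in_V d = t4].

Lemma ext_braid_supp R Psi c d a b :
  ext_braid R Psi c d a b != 0 -> in_V c = in_V b /\ in_V d = in_V a.
Proof. by case: a b c d => [?|?] [?|?] [?|?] [?|?]; rewrite /= ?eqxx. Qed.

Lemma sum_neq0 (J : finType) (F : J -> K) :
  \sum_j F j != 0 -> exists j, F j != 0.
Proof.
move=> F0; apply/existsP/contraT; rewrite negb_exists => /forallP Fj.
by move: F0; rewrite big1 ?eqxx // => j _; apply/eqP/negPn.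
Qed.

Lemma ext_braid12_supp R Psi t1 t2 t3 t4 v :
  supp4 t1 t2 t3 t4 v -> supp4 t2 t1 t3 t4 (ext_braid12 R Psi v).
Proof.
move=> vt a b c d /sum_neq0[a' /sum_neq0[b']].
by rewrite mulf_eq0 negb_or => /andP[/ext_braid_supp[-> ->] /vt[]].
Qed.
Lemma ext_braid23_supp R Psi t1 t2 t3 t4 v :
  supp4 t1 t2 t3 t4 v -> supp4 t1 t3 t2 t4 (ext_braid23 R Psi v).
Proof.
move=> vt a b c d /sum_neq0[a' /sum_neq0[b']].
by rewrite mulf_eq0 negb_or => /andP[/ext_braid_supp[-> ->] /vt[]].
Qed.
Lemma ext_braid34_supp R Psi t1 t2 t3 t4 v :
  supp4 t1 t2 t3 t4 v -> supp4 t1 t2 t4 t3 (ext_braid34 R Psi v).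
Proof.
move=> vt a b c d /sum_neq0[a' /sum_neq0[b']].
by rewrite mulf_eq0 negb_or => /andP[/ext_braid_supp[-> ->] /vt[]].
Qed.

(* braid_word preserves V (x) V^* (x) V (x) V^*, so that nothing is dropped in
   braid_End. *)
Lemma braid_EndE R Psi T a b c d :
  braid_word R Psi (End2_incl T) a b c d =
  End2_incl (braid_End R Psi T) a b c d.
Proof.
have sT : supp4 true false true false
    (braid_word R Psi (End2_incl T)).
  apply: ext_braid23_supp; apply: ext_braid12_supp.
  apply: ext_braid34_supp; apply: ext_braid23_supp.
  by case=> [?|?] [?|?] [?|?] [?|?] /=; rewrite ?eqxx.
move: (sT a b c d); case: a b c d => [i|i] [j|j] [k|k] [s|s] //= z;
  by apply/eqP/negbNE/negP => /z[].
Qed.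

End Braiding.

Section Relations.
Variables (K : fieldType) (N : nat) (R Psi : 'M[K]_(N * N)).

Section InAlgebra.
Variables (A : lalgType K) (l : 'I_N -> 'I_N -> A).

Definition eval1 (X : 'M[K]_N) : A := \sum_i \sum_j X i j *: l i j.
Definition eval2 (T : End2 K N) : A :=
  \sum_i \sum_j \sum_k \sum_s T i j k s *: (l i j * l k s).

Definition UREnd_rel (X Y : 'M[K]_N) : A :=
  let XY := End2_tensor X Y in
  let RXY := braid_End R Psi XY in
  eval2 XY - eval2 RXY - eval1 (End2_comp Psi XY) + eval1 (End2_comp Psi RXY).

(* Rows of R-bar are numbered by the lower indices of R, columns by the upper
   ones: this is the transpose in the convention of coef2. *)
Definition Rbar : 'M[A]_(N * N) := map_mx (in_alg A) R^T.
Definition L1 : 'M[A]_(N * N) := (\matrix_(i, j) l i j) *t 1%:M.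

Definition REA_rel (hbar : K) : 'M[A]_(N * N) :=
  Rbar *m L1 *m Rbar *m L1 - L1 *m Rbar *m L1 *m Rbar
  - hbar%:A *: (Rbar *m L1 - L1 *m Rbar).

Lemma UREnd_rel_aug (f : {lrmorphism A -> K | *%R}) X Y :
  (forall i j, f (l i j) = 0) -> f (UREnd_rel X Y) = 0.
Proof.
move=> fl.
have f1 U : f (eval1 U) = 0.
  rewrite raddf_sum big1 // => i _; rewrite raddf_sum big1 // => j _.
  by rewrite /= linearZ /= fl mulr0.
have f2 U : f (eval2 U) = 0.
  rewrite raddf_sum big1 // => i _; rewrite raddf_sum big1 // => j _.
  rewrite raddf_sum big1 // => k _; rewrite raddf_sum big1 // => s _.
  by rewrite /= linearZ /= rmorphM /= fl mul0r mulr0.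
have faug U V X1 X2 : f (eval2 U - eval2 V - eval1 X1 + eval1 X2) = 0.
  move: (f2 U) (f2 V) (f1 X1) (f1 X2).
  move: (eval2 U) (eval2 V) (eval1 X1) (eval1 X2) => a b c d a0 b0 c0 d0.
  by rewrite raddfD /= 2!raddfB /= a0 b0 c0 d0 !subr0 addr0.
exact: faug.
Qed.

Lemma REA_rel_aug (f : {rmorphism A -> K}) (hbar : K) p q :
  (forall i j, f (l i j) = 0) -> f (REA_rel hbar p q) = 0.
Proof.
move=> fl; have fL : map_mx f L1 = 0.
  by apply/matrixP=> i j; rewrite 2!mxE rmorphM /= mxE fl mul0r [RHS]mxE.
have: map_mx f (REA_rel hbar) = 0.
  rewrite /REA_rel !(map_mxB, map_mxZ, map_mxM) /= fL.
  by rewrite !(mulmx0, mul0mx, subr0, scaler0).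
by move: (REA_rel _) => M /matrixP/(_ p q); rewrite !mxE.
Qed.
End InAlgebra.

(* The tensor algebra of V (x) V^*, free on the basis vectors l_i^j. *)
Definition tensor_alg : algType K := free_alg K ('I_N * 'I_N)%type.

Definition lgen (i j : 'I_N) : tensor_alg := free_gen K (i, j).

Definition UREnd_rels (x : tensor_alg) := exists X Y, x = UREnd_rel lgen X Y.
Definition REA_rels (hbar : K) (x : tensor_alg) :=
  exists p q, x = REA_rel lgen hbar p q.

Lemma UREnd_proper : ~ ideal_gen UREnd_rels 1.
Proof.
apply: aug_proper => _ [X [Y ->]].
by apply: (UREnd_rel_aug (f := @free_aug K _)) => i j; apply: free_aug_gen.
Qed.

Lemma REA_proper hbar : ~ ideal_gen (REA_rels hbar) 1.
Proof.
apply: aug_proper => _ [p [q ->]].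
by apply: (REA_rel_aug (f := @free_aug K _)) => i j; apply: free_aug_gen.
Qed.

Definition UREnd : algType K := presented UREnd_proper.
Definition UREnd_gen (i j : 'I_N) : UREnd := to_presented UREnd_proper (lgen i j).

Definition REA (hbar : K) : algType K := presented (@REA_proper hbar).
Definition REA_gen (hbar : K) (i j : 'I_N) : REA hbar :=
  to_presented (@REA_proper hbar) (lgen i j).

End Relations.

Arguments UREnd_proper {K N} R Psi _.
Arguments REA_proper {K N} R hbar _.

(* Main.v *)
(* The contraction F |-> R^{fb}_{ea} F_{i,e,f,s}, read as an (i,a) x (s,b)
   matrix, is invertible because R is skew-invertible: its inverse is the
   contraction with Psi.  It sends the family l_i^j l_k^s to L1 Rbar L1, the
   family B^j_k l_i^s to L1, and intertwines R_End with M |-> Rbar M Rbar.  Hence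
   it turns the relations of U_R(End V) into H = Rbar H Rbar, with
   H = L1 Rbar L1 - L1.  As Rbar^2 = 1, multiplying by Rbar on the left gives
   Rbar H = H Rbar, the reflection equation with hbar = 1. *)
Require Import Defs.
From HB Require Import structures.
From mathcomp Require Import all_boot all_order all_algebra.
From mathcomp.real_closed Require Import mxtens.

Set Implicit Arguments.
Unset Strict Implicit.
Unset Printing Implicit Defensive.

Import GRing.Theory.
Local Open Scope ring_scope.

(** * Finite sums over pairs of indices and Kronecker deltas *)

Section TensorSums.
Variables (K : fieldType) (N : nat).

Lemma big_mxtens (V : nmodType) m n (F : 'I_(m * n) -> V) :
  \sum_p F p = \sum_i \sum_j F (mxtens_index (i, j)).
Proof.
rewrite pair_big /= (reindex (@mxtens_index m n)) /=.
  by apply: eq_bigr => -[i j].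
by exists (@mxtens_unindex m n) => i; rewrite (mxtens_indexK, mxtens_unindexK).
Qed.

Lemma sum_delta (V : lmodType K) (I : finType) (i : I) (F : I -> V) :
  \sum_j (i == j)%:R *: F j = F i.
Proof.
rewrite (bigD1 i) //= eqxx scale1r big1 ?addr0 // => j /negPf ij.
by rewrite eq_sym ij scale0r.
Qed.

Lemma sum2_delta (V : lmodType K) (I J : finType) (i : I) (j : J)
    (F : I -> J -> V) :
  \sum_i' \sum_j' ((i == i')%:R * (j == j')%:R) *: F i' j' = F i j.
Proof.
rewrite -[RHS](sum_delta i (F^~ j)); apply: eq_bigr => i' _.
rewrite -(sum_delta j (F i')) scaler_sumr.
by apply: eq_bigr => j' _; rewrite scalerA.
Qed.

(** Transposition of the kernel [m]: a linear map acting on the coefficients [v] is traded for its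
    transpose acting on the vectors [F]. This is the tool by which a braiding is moved from a tensor
    to a family in the algebra. *)
Lemma sum2_adjoint (V : lmodType K) (I J I' J' : finType)
    (m : I -> J -> I' -> J' -> K) (v : I' -> J' -> K) (F : I -> J -> V) :
  \sum_a \sum_b (\sum_c \sum_d m a b c d * v c d) *: F a b =
  \sum_c \sum_d v c d *: \sum_a \sum_b m a b c d *: F a b.
Proof.
under eq_bigr do under eq_bigr do rewrite pair_big scaler_suml.
rewrite pair_big /= exchange_big /= [RHS]pair_big /=.
apply: eq_bigr => -[c d] _ /=; rewrite pair_big /= scaler_sumr.
by apply: eq_bigr => -[a b] _ /=; rewrite scalerA mulrC.
Qed.

End TensorSums.

(** * The braiding of End(V) in coordinates *)

Section BraidEnd.
Variables (K : fieldType) (N : nat) (R Psi : 'M[K]_(N * N)).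
Implicit Type v : tensor4 K N.

(** The extended braiding swaps the types V and V^*, so a target of given types receives
    contributions from one pair of source types only; the other blocks of the sum vanish. The next
    three lemmas rest on the same remark. *)
Lemma ext_braid23_mixed v p e f d :
  ext_braid23 R Psi v p (inr e) (inl f) d =
  \sum_q \sum_c coef2 (invmx R) f c e q * v p (inl q) (inr c) d.
Proof.
rewrite /ext_braid23 big_sumType /= [X in _ + X]big1 ?addr0 => [|q _].
  apply: eq_bigr => q _; rewrite big_sumType /= big1 ?add0r // => c _.
  by rewrite mul0r.
by rewrite big_sumType /= !big1 ?addr0 // => c _; rewrite mul0r.
Qed.

Lemma ext_braid23_dual v p a b d :
  ext_braid23 R Psi v p (inl a) (inr b) d =
  \sum_j \sum_k coef2 Psi a j b k * v p (inr j) (inl k) d.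
Proof.
rewrite /ext_braid23 big_sumType /= [X in X + _]big1 ?add0r => [|q _].
  apply: eq_bigr => q _; rewrite big_sumType /= [X in _ + X]big1 ?addr0 //.
  by move=> c _; rewrite mul0r.
by rewrite big_sumType /= !big1 ?addr0 // => c _; rewrite mul0r.
Qed.

Lemma ext_braid12_VV v p q c d :
  ext_braid12 R Psi v (inl p) (inl q) c d =
  \sum_i \sum_a coef2 R p q i a * v (inl i) (inl a) c d.
Proof.
rewrite /ext_braid12 big_sumType /= [X in _ + X]big1 ?addr0 => [|i _].
  apply: eq_bigr => i _; rewrite big_sumType /= [X in _ + X]big1 ?addr0 //.
  by move=> a _; rewrite mul0r.
by rewrite big_sumType /= !big1 ?addr0 // => a _; rewrite mul0r.
Qed.

Lemma ext_braid34_dual v a b c d :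
  ext_braid34 R Psi v a b (inr c) (inr d) =
  \sum_b' \sum_s coef2 R s b' d c * v a b (inr b') (inr s).
Proof.
rewrite /ext_braid34 big_sumType /= [X in X + _]big1 ?add0r => [|b' _].
  apply: eq_bigr => b' _; rewrite big_sumType /= big1 ?add0r // => s _.
  by rewrite mul0r.
by rewrite big_sumType /= !big1 ?addr0 // => s _; rewrite mul0r.
Qed.

(** Starting from V (x) V^* (x) V (x) V^*, each letter of the braid word meets a single case of the
    extended braiding: [Psi] for the innermost letter, [R] for the two middle ones, the inverse of
    [R] for the outermost. *)
Lemma braid_End_coef (T : End2 K N) p e f d :
  braid_End R Psi T p e f d =
  \sum_q \sum_c coef2 (invmx R) f c e q *
    \sum_i \sum_a coef2 R p q i a *
      \sum_b \sum_s coef2 R s b d c *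
        \sum_j \sum_k coef2 Psi a j b k * T i j k s.
Proof.
rewrite /braid_End /braid_word ext_braid23_mixed.
under eq_bigr => q _ do under eq_bigr => c _ do rewrite ext_braid12_VV.
under eq_bigr => q _ do under eq_bigr => c _ do under eq_bigr => i _ do
  under eq_bigr => a _ do rewrite ext_braid34_dual.
under eq_bigr => q _ do under eq_bigr => c _ do under eq_bigr => i _ do
  under eq_bigr => a _ do under eq_bigr => b _ do under eq_bigr => s _ do
  rewrite ext_braid23_dual.
by [].
Qed.

End BraidEnd.

(** * Contraction with R, its inverse, and the transport of the braiding *)

Section Contraction.
Variables (K : fieldType) (N : nat) (R Psi : 'M[K]_(N * N)).
Hypotheses (RR : R *m R = 1%:M) (hPsi : skew_inverse R Psi).
Variables (A : algType K).
Implicit Types (F : 'I_N -> 'I_N -> 'I_N -> 'I_N -> A) (M : 'M[A]_(N * N)).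
Local Notation ix i j := (mxtens_index (i, j)).

(** Linear extension of a family [F] given on the basis l_i^j (x) l_k^s. Both the product and the
    composition terms of the relations have this shape, so the computation can be carried out on [F]
    alone. *)
Definition pairing (T : End2 K N) F : A :=
  \sum_i \sum_j \sum_k \sum_s T i j k s *: F i j k s.

Definition R_contr F : 'M[A]_(N * N) := \matrix_(p, q)
  let: (i, a) := mxtens_unindex p in let: (s, b) := mxtens_unindex q in
  \sum_e \sum_f coef2 R f b e a *: F i e f s.

Definition Psi_contr M i j k s : A :=
  \sum_a \sum_b coef2 Psi a j b k *: M (ix i a) (ix s b).

Lemma R_contrE F i a s b :
  R_contr F (ix i a) (ix s b) = \sum_e \sum_f coef2 R f b e a *: F i e f s.
Proof. by rewrite mxE !mxtens_indexK. Qed.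

Lemma R_contrK F i j k s : Psi_contr (R_contr F) i j k s = F i j k s.
Proof.
rewrite /Psi_contr; under eq_bigr do under eq_bigr do rewrite R_contrE.
rewrite -(sum2_adjoint (fun e f a b => coef2 R f b e a)
  (fun a b => coef2 Psi a j b k)) -(sum2_delta j k (fun e f => F i e f s)).
apply: eq_bigr => e _; apply: eq_bigr => f _; congr (_ *: _).
by rewrite exchange_big /= (hPsi _ _ _ _).1 mulrC [k == f]eq_sym.
Qed.

Lemma Psi_contrK M : R_contr (Psi_contr M) = M.
Proof.
apply/matrixP=> p q; case: (mxtens_indexP p) => i t; case: (mxtens_indexP q) => s u.
rewrite R_contrE -(sum2_adjoint (fun a b e f => coef2 Psi a e b f)
  (fun e f => coef2 R f u e t))
  -(sum2_delta t u (fun a b => M (ix i a) (ix s b))).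
apply: eq_bigr => a _; apply: eq_bigr => b _; congr (_ *: _).
by rewrite (hPsi _ _ _ _).2 [t == a]eq_sym.
Qed.

Lemma Rbar_mull M i a q :
  (Rbar R A *m M) (ix i a) q = \sum_p \sum_t coef2 R p t i a *: M (ix p t) q.
Proof.
rewrite mxE big_mxtens; apply: eq_bigr => p _; apply: eq_bigr => t _.
by rewrite !mxE mulr_algl.
Qed.

Lemma Rbar_mulr M p s b :
  (M *m Rbar R A) p (ix s b) = \sum_d \sum_c coef2 R s b d c *: M p (ix d c).
Proof.
rewrite mxE big_mxtens; apply: eq_bigr => d _; apply: eq_bigr => c _.
by rewrite !mxE mulr_algr.
Qed.

Lemma Rbar2 : Rbar R A *m Rbar R A = 1%:M.
Proof. by rewrite /Rbar -map_mxM -trmx_mul RR trmx1 map_mx1. Qed.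

(** The four letters of the braid word are moved from [T] to [F] one at a time, outermost first,
    each by [sum2_adjoint]. *)
Lemma pairing_braid_End T F :
  pairing (braid_End R Psi T) F =
  pairing T (Psi_contr (Rbar R A *m R_contr F *m Rbar R A)).
Proof.
(* The outermost letter carries the inverse of [R]; involutivity turns it into [R], the kernel of
   [R_contr]. *)
have invR : invmx R = R.
  by rewrite -[LHS]mulmx1 -RR mulmxA mulVmx ?mul1mx //; case/mulmx1_unit: RR.
rewrite /pairing; under eq_bigr do under eq_bigr do under eq_bigr do
  under eq_bigr do rewrite braid_End_coef invR.
(* The outermost R_23 becomes [R_contr] on the family. *)
transitivity (\sum_p \sum_d \sum_q \sum_c (
    \sum_i \sum_a coef2 R p q i a *
      \sum_b \sum_s coef2 R s b d c *
        \sum_j \sum_k coef2 Psi a j b k * T i j k s)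
  *: R_contr F (ix p q) (ix d c)).
  apply: eq_bigr => p _.
  under eq_bigr do rewrite exchange_big /=.
  rewrite exchange_big /=; apply: eq_bigr => d _.
  rewrite (sum2_adjoint (fun e f q c => coef2 R f c e q)).
  by apply: eq_bigr => q _; apply: eq_bigr => c _; rewrite R_contrE.
(* R_12, acting on V (x) V, becomes left multiplication by [Rbar]. *)
transitivity (\sum_d \sum_c \sum_i \sum_a (
      \sum_b \sum_s coef2 R s b d c *
        \sum_j \sum_k coef2 Psi a j b k * T i j k s)
  *: (Rbar R A *m R_contr F) (ix i a) (ix d c)).
  rewrite exchange_big /=; apply: eq_bigr => d _.
  under eq_bigr do rewrite exchange_big /=.
  rewrite exchange_big /=; apply: eq_bigr => c _.
  rewrite (sum2_adjoint (fun p q i a => coef2 R p q i a)).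
  by apply: eq_bigr => i _; apply: eq_bigr => a _; rewrite Rbar_mull.
(* R_34, acting on V^* (x) V^*, becomes right multiplication by [Rbar]. *)
transitivity (\sum_i \sum_s \sum_a \sum_b
    (\sum_j \sum_k coef2 Psi a j b k * T i j k s)
  *: (Rbar R A *m R_contr F *m Rbar R A) (ix i a) (ix s b)).
  under eq_bigr do rewrite exchange_big /=.
  rewrite exchange_big /=; apply: eq_bigr => i _.
  under eq_bigr do rewrite exchange_big /=.
  rewrite exchange_big /= [RHS]exchange_big /=; apply: eq_bigr => a _.
  rewrite (sum2_adjoint (fun d c b s => coef2 R s b d c)) exchange_big /=.
  by apply: eq_bigr => s _; apply: eq_bigr => b _; rewrite Rbar_mulr.
(* What remains is the innermost R_23, whose kernel [Psi] gives [Psi_contr]. *)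
apply: eq_bigr => i _.
under [RHS]eq_bigr do rewrite exchange_big /=.
rewrite [RHS]exchange_big /=; apply: eq_bigr => s _.
by rewrite (sum2_adjoint (fun a b j k => coef2 Psi a j b k)).
Qed.

Variable l : 'I_N -> 'I_N -> A.

Lemma L1_mull M i a q : (L1 l *m M) (ix i a) q = \sum_e l i e * M (ix e a) q.
Proof.
rewrite mxE big_mxtens; apply: eq_bigr => e _; rewrite (bigD1 a) //= big1.
  by rewrite addr0 tensmxE !mxE eqxx mulr1.
by move=> b ba; rewrite tensmxE !mxE eq_sym (negPf ba) mulr0 mul0r.
Qed.

Lemma Rbar_L1E i a s b :
  (Rbar R A *m L1 l) (ix i a) (ix s b) = \sum_f coef2 R f b i a *: l f s.
Proof.
rewrite Rbar_mull; apply: eq_bigr => f _; rewrite (bigD1 b) //= big1.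
  by rewrite addr0 tensmxE !mxE eqxx mulr1.
by move=> t tb; rewrite tensmxE !mxE (negPf tb) mulr0 scaler0.
Qed.

Lemma R_contr_mul :
  R_contr (fun i j k s => l i j * l k s) = L1 l *m Rbar R A *m L1 l.
Proof.
apply/matrixP=> p q; case: (mxtens_indexP p) => i a; case: (mxtens_indexP q) => s b.
rewrite R_contrE -mulmxA L1_mull; apply: eq_bigr => e _.
rewrite Rbar_L1E mulr_sumr; apply: eq_bigr => f _.
by rewrite -scalerAr.
Qed.

(** [Bmx] is a partial trace of [Psi], and [L1] is the identity on the traced factor; hence the
    family is [Psi_contr] of [L1], and [Psi_contrK] applies. *)
Lemma R_contr_comp : R_contr (fun i j k s => Bmx Psi j k *: l i s) = L1 l.
Proof.
rewrite -[RHS]Psi_contrK; apply/matrixP=> p q.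
case: (mxtens_indexP p) => i a; case: (mxtens_indexP q) => s b.
rewrite !R_contrE; apply: eq_bigr => e _; apply: eq_bigr => f _.
congr (_ *: _); rewrite /Psi_contr mxE scaler_suml; apply: eq_bigr => t _.
rewrite (bigD1 t) //= big1 ?addr0.
  by rewrite tensmxE !mxE eqxx mulr1.
by move=> u ut; rewrite tensmxE !mxE eq_sym (negPf ut) mulr0 scaler0.
Qed.

Lemma eval1_End2_comp T :
  eval1 l (End2_comp Psi T) = pairing T (fun i j k s => Bmx Psi j k *: l i s).
Proof.
apply: eq_bigr => i _.
under [RHS]eq_bigr do rewrite exchange_big /=.
rewrite [RHS]exchange_big /=; apply: eq_bigr => s _.
rewrite mxE scaler_suml; apply: eq_bigr => j _.
by rewrite scaler_suml; apply: eq_bigr => k _; rewrite scalerA.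
Qed.

End Contraction.

(** * Equivalence of the two systems of relations in an arbitrary algebra *)

Section Equivalence.
Variables (K : fieldType) (N : nat) (R Psi : 'M[K]_(N * N)).
Hypotheses (RR : R *m R = 1%:M) (hPsi : skew_inverse R Psi).
Variables (A : algType K).
Implicit Types (F : 'I_N -> 'I_N -> 'I_N -> 'I_N -> A) (M : 'M[A]_(N * N)).

Lemma pairing_delta F i j k s :
  pairing (End2_tensor (delta_mx i j) (delta_mx k s)) F = F i j k s.
Proof.
transitivity (\sum_i' \sum_j' ((i == i')%:R * (j == j')%:R) *:
    \sum_k' \sum_s' ((k == k')%:R * (s == s')%:R : K) *: F i' j' k' s').
  apply: eq_bigr => i' _; apply: eq_bigr => j' _; rewrite scaler_sumr.
  apply: eq_bigr => k' _; rewrite scaler_sumr; apply: eq_bigr => s' _.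
  rewrite scalerA /End2_tensor !mxE ![_ == i']eq_sym ![_ == j']eq_sym.
  by rewrite ![_ == k']eq_sym ![_ == s']eq_sym -!mulnb !natrM.
by rewrite !sum2_delta.
Qed.

Lemma pairing_Psi_contrB T M M' :
  pairing T (Psi_contr Psi (M - M')) =
  pairing T (Psi_contr Psi M) - pairing T (Psi_contr Psi M').
Proof.
rewrite /pairing -sumrB; apply: eq_bigr => i _.
rewrite -sumrB; apply: eq_bigr => j _.
rewrite -sumrB; apply: eq_bigr => k _.
rewrite -sumrB; apply: eq_bigr => s _.
rewrite -scalerBr; congr (_ *: _).
rewrite -sumrB; apply: eq_bigr => a _.
rewrite -sumrB; apply: eq_bigr => b _.
by rewrite -scalerBr !mxE.
Qed.

Lemma pairing_R_contrK T F :
  pairing T (Psi_contr Psi (R_contr R F)) = pairing T F.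
Proof.
by do 4![apply: eq_bigr => ? _]; rewrite R_contrK.
Qed.

(** Pairing with matrix units reads off every entry of [Psi_contr Psi M], so tensors of the form X
    (x) Y suffice; [M] is then recovered by contracting with [R]. *)
Lemma pairing_Psi_contr_eq0 M :
  (forall X Y, pairing (End2_tensor X Y) (Psi_contr Psi M) = 0) <-> M = 0.
Proof.
split=> [M0|-> X Y]; last first.
  by rewrite -(subrr 0) pairing_Psi_contrB subrr.
rewrite -(Psi_contrK hPsi M); apply/matrixP=> p q; rewrite !mxE.
case: (mxtens_unindex p) => i a; case: (mxtens_unindex q) => s b.
rewrite big1 // => e _; rewrite big1 // => f _.
by rewrite -pairing_delta M0 scaler0.
Qed.

Variable l : 'I_N -> 'I_N -> A.
Local Notation Rb := (Rbar R A).
Local Notation L := (L1 l).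

(** By [R_contrK] every family may be replaced by [Psi_contr] of its contraction; the two braided
    terms then differ from the others only by the conjugation with [Rbar] found in
    [pairing_braid_End]. *)
Lemma UREnd_relE X Y :
  UREnd_rel R Psi l X Y =
  pairing (End2_tensor X Y) (Psi_contr Psi
    ((L *m Rb *m L - L) - Rb *m (L *m Rb *m L - L) *m Rb)).
Proof.
have mulE T : eval2 l T = pairing T (Psi_contr Psi (L *m Rb *m L)).
  by rewrite -R_contr_mul pairing_R_contrK.
have compE T : eval1 l (End2_comp Psi T) = pairing T (Psi_contr Psi L).
  by rewrite -[in RHS](R_contr_comp hPsi) pairing_R_contrK eval1_End2_comp.
rewrite mulmxBr mulmxBl !pairing_Psi_contrB /UREnd_rel.
(* The braided composition term is first put in the form of a pairing, so that [compE] affects only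
   the unbraided one. *)
rewrite [X in _ + X]eval1_End2_comp.
rewrite pairing_braid_End // R_contr_comp // compE mulE.
rewrite -[eval2 _ _]/(pairing _ (fun i j k s => l i j * l k s)).
rewrite pairing_braid_End // R_contr_mul.
by rewrite opprB [RHS]addrA [RHS]addrAC [X in X + _]addrAC.
Qed.

Lemma UREnd_relP :
  (forall X Y, UREnd_rel R Psi l X Y = 0) <->
  Rb *m L *m Rb *m L - L *m Rb *m L *m Rb - (Rb *m L - L *m Rb) = 0.
Proof.
set M := (L *m Rb *m L - L) - Rb *m (L *m Rb *m L - L) *m Rb.
have -> : Rb *m L *m Rb *m L - L *m Rb *m L *m Rb - (Rb *m L - L *m Rb)
    = Rb *m M.
  rewrite /M !(mulmxBr, mulmxBl) !mulmxA Rbar2 // !mul1mx.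
  rewrite !opprB !addrA [LHS]addrAC [RHS]addrAC.
  by congr (_ + _); rewrite addrAC.
split=> [rel0|RM0 X Y]; last first.
  (* No information is lost in [Rb *m M], since [M] equals [Rb *m (Rb *m M)]. *)
  by rewrite UREnd_relE -/M -[M]mul1mx -(Rbar2 RR) -mulmxA RM0 mulmx0;
    move: X Y; apply/pairing_Psi_contr_eq0.
have /pairing_Psi_contr_eq0 -> : forall X Y,
    pairing (End2_tensor X Y) (Psi_contr Psi M) = 0.
  by move=> X Y; rewrite -UREnd_relE.
by rewrite mulmx0.
Qed.

End Equivalence.

(** * Compatibility of both kinds of relations with algebra morphisms *)

Section Naturality.
Variables (K : fieldType) (N : nat) (R Psi : 'M[K]_(N * N)).
Variables (A B : algType K) (g : {lrmorphism A -> B}).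
Variables (l : 'I_N -> 'I_N -> A) (l' : 'I_N -> 'I_N -> B).
Hypothesis gl : forall i j, g (l i j) = l' i j.

Lemma rmorph_UREnd_rel X Y :
  g (UREnd_rel R Psi l X Y) = UREnd_rel R Psi l' X Y.
Proof.
have g1 U : g (eval1 l U) = eval1 l' U.
  rewrite raddf_sum; apply: eq_bigr => i _; rewrite raddf_sum.
  by apply: eq_bigr => j _; rewrite /= linearZ /= gl.
have g2 U : g (eval2 l U) = eval2 l' U.
  rewrite raddf_sum; apply: eq_bigr => i _; rewrite raddf_sum.
  apply: eq_bigr => j _; rewrite raddf_sum; apply: eq_bigr => k _.
  rewrite raddf_sum; apply: eq_bigr => s _.
  by rewrite /= linearZ /= rmorphM /= !gl.
by rewrite /UREnd_rel rmorphD !rmorphB /= !g1 !g2.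
Qed.

Lemma map_REA_rel hbar :
  map_mx g (REA_rel R l hbar) = REA_rel R l' hbar.
Proof.
have gR : map_mx g (Rbar R A) = Rbar R B.
  by apply/matrixP=> p q; rewrite !mxE; exact: rmorph_alg.
have gL : map_mx g (L1 l) = L1 l'.
  by apply/matrixP=> p q; rewrite !mxE rmorphM /= gl rmorph_nat.
rewrite /REA_rel !(map_mxB, map_mxZ, map_mxM) /= gR gL.
by rewrite (rmorph_alg g).
Qed.

End Naturality.

(** * Quotients by two sets of relations generating the same ideal *)

Lemma ideal_gen_sub (T : nzRingType) (S S' : T -> Prop) :
  (forall x, S x -> ideal_gen S' x) ->
  forall x, ideal_gen S x -> ideal_gen S' x.
Proof.
move=> SS' x; elim=> {x}; [exact: SS'| | | |].
- exact: ideal_gen0.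
- by move=> *; apply: ideal_genD.
- by move=> *; apply: ideal_genMl.
- by move=> *; apply: ideal_genMr.
Qed.

Section PresentedEq.
Variables (K : comNzRingType) (T : algType K) (S S' : T -> Prop).
Hypotheses (S1 : ~ ideal_gen S 1) (S'1 : ~ ideal_gen S' 1).

Hypotheses (SS' : forall x, S x -> ideal_gen S' x)
           (S'S : forall x, S' x -> ideal_gen S x).

Lemma presented_iso : exists f : {lrmorphism presented S1 -> presented S'1},
  bijective f /\ forall x, f (to_presented S1 x) = to_presented S'1 x.
Proof.
(* The choice of representative does not matter, because the ideal of [S] lies in that of [S']; this
   is [fE], from which the morphism laws follow. *)
pose f (u : presented S1) := to_presented S'1 (presented_repr u).
have fE x : f (to_presented S1 x) = to_presented S'1 x.
  by apply/to_presentedP/(ideal_gen_sub SS')/presented_reprB.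
have fB : zmod_morphism f.
  by elim/pres_ind=> x; elim/pres_ind=> y; rewrite -rmorphB !fE rmorphB.
have fM : monoid_morphism f.
  split=> [|u v]; first by rewrite -(rmorph1 (to_presented S1)) fE rmorph1.
  elim/pres_ind: u => x; elim/pres_ind: v => y.
  by rewrite -rmorphM !fE rmorphM.
have fZ : scalable f.
  by move=> a; elim/pres_ind=> x; rewrite -linearZ !fE linearZ.
pose fB' := GRing.isZmodMorphism.Build _ _ f fB.
pose fM' := GRing.isMonoidMorphism.Build _ _ f fM.
pose fZ' := GRing.isScalable.Build K _ _ *:%R f fZ.
pose g : {lrmorphism presented S1 -> presented S'1} :=
  HB.pack f fB' fM' fZ'.
(* The inverse is the same construction with [S] and [S'] exchanged. *)
exists g; split=> //; exists (fun u => to_presented S1 (presented_repr u)).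
  elim/pres_ind=> x; rewrite [g _]fE /=.
  by apply/to_presentedP/(ideal_gen_sub S'S)/presented_reprB.
by elim/pres_ind=> x; rewrite [g _]fE presented_reprK.
Qed.

End PresentedEq.

Lemma to_presented_eq0 (K : comNzRingType) (T : algType K) (S : T -> Prop)
    (S1 : ~ ideal_gen S 1) x :
  to_presented S1 x = 0 <-> ideal_gen S x.
Proof.
by rewrite -[0](to_presented0 S1) to_presentedP subr0.
Qed.

Theorem proposition19 (K : fieldType) (N : nat) (R Psi : 'M[K]_(N * N))
    (hR : involutive_symmetry R) (hPsi : skew_inverse R Psi) :
  (forall (A : algType K) (l : 'I_N -> 'I_N -> A),
     (forall X Y : 'M[K]_N, UREnd_rel R Psi l X Y = 0) <->
     Rbar R A *m L1 l *m Rbar R A *m L1 l - L1 l *m Rbar R A *m L1 l *m Rbar R A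
       - (Rbar R A *m L1 l - L1 l *m Rbar R A) = 0)
  /\ exists f : {lrmorphism UREnd R Psi -> REA R 1},
       bijective f /\ forall i j, f (UREnd_gen R Psi i j) = REA_gen R 1 i j.
Proof.
case: hR => _ RR.
have relP (A : algType K) (l : 'I_N -> 'I_N -> A) :
    (forall X Y, UREnd_rel R Psi l X Y = 0) <-> REA_rel R l 1 = 0.
  by rewrite /REA_rel !scale1r; exact: UREnd_relP.
split=> [A l|]; first exact: UREnd_relP.
have gU i j :
  to_presented (UREnd_proper R Psi) (lgen K i j) = UREnd_gen R Psi i j by [].
have gL i j :
  to_presented (REA_proper R 1) (lgen K i j) = REA_gen R 1 i j by [].
(* Membership in the ideal is tested by vanishing in the quotient. There, by naturality, the image
   of the relation is the same relation among the generators of [REA R 1], and [relP] for that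
   algebra reduces it to the reflection equation, which holds by construction. *)
have UREnd_REA x : UREnd_rels R Psi x -> ideal_gen (REA_rels R 1) x.
  case=> X [Y ->]; apply/(to_presented_eq0 (REA_proper R 1)).
  rewrite (rmorph_UREnd_rel R Psi gL); move: X Y; apply/relP.
  rewrite -(map_REA_rel R gL); apply/matrixP=> p q; rewrite mxE [RHS]mxE.
  by apply/to_presented_eq0/ideal_gen_in; exists p, q.
(* The converse applies [relP] in [UREnd R Psi]; the matrix identity obtained is then read at the
   entry [p], [q]. *)
have REA_UREnd x : REA_rels R 1 x -> ideal_gen (UREnd_rels R Psi) x.
  case=> p [q ->]; apply/(to_presented_eq0 (UREnd_proper R Psi)).
  have relU : REA_rel R (UREnd_gen R Psi) 1 = 0.
    apply/relP=> X Y; rewrite -(rmorph_UREnd_rel R Psi gU).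
    by apply/to_presented_eq0/ideal_gen_in; exists X, Y.
  have /matrixP/(_ p q) := map_REA_rel R gU 1.
  by rewrite relU [LHS]mxE [RHS]mxE.
have [f [f_bij fE]] :=
  presented_iso (UREnd_proper R Psi) (REA_proper R 1) UREnd_REA REA_UREnd.
by exists f; split=> // i j; exact: fE.
Qed.
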